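(* Let $w\in S_n$ avoid the patterns $3412$ and $4231$, and let $e_1,\dots,e_n$ be defined as follows: for $i\in\{1,\dots,n\}$, let $r\le i$ be the largest record position of $w$ with $r\le i$, and let $r'$ be the smallest record position of $w$ with $r'>i$ (with $r'=+\infty$ if there is none); set $$e_i=\#\{j\mid r\le j<i,\ w(j)>w(i)\}+\#\{k\mid r'\le k\le n,\ w(k)<w(i)\}.$$ Then $$P_w(q)=R_w(q)=[e_1+1]_q\,[e_2+1]_q\cdots[e_n+1]_q,$$ where $[a]_q=1+q+\cdots+q^{a-1}$.
   Context: An index $r\in\{1,\dots,n\}$ is a record position of $w\in S_n$ if $w(r)>\max(w(1),\dots,w(r-1))$ (so $1$ is always a record position). $\ell(w)$ is the number of inversions of $w$; $\le$ is the strong Bruhat order on $S_n$ (generated by $w<w t_{ij}$ whenever $\ell(w)<\ell(wt_{ij})$, $t_{ij}$ a transposition), and $P_w(q)=\sum_{u\le w}q^{\ell(u)}$. The inversion graph $G_w$ has vertex set $\{1,\dots,n\}$ and edges $\{i,j\}$ for $i<j$, $w(i)>w(j)$. For a graph $G$ on $\{1,\dots,n\}$, $R_G(q)=\sum_{\mathcal{O}}q^{\mathrm{des}(\mathcal{O})}$, the sum over all acyclic orientations $\mathcal{O}$ of $G$, where $\mathrm{des}(\mathcal{O})$ is the number of edges oriented $i\to j$ with $i>j$; and $R_w(q)=R_{G_w}(q)$. Pattern avoidance: $w$ avoids $\sigma\in S_k$ if no subsequence of $w(1)\cdots w(n)$ of length $k$ has the same relative order as $\sigma$. *)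

(* Defs.v *)
From mathcomp Require Import all_boot all_order all_algebra all_fingroup.

Set Implicit Arguments.
Unset Strict Implicit.
Unset Printing Implicit Defensive.

Import GRing.Theory.
Local Open Scope ring_scope.

(* Throughout, positions and values are 0-based: [n] is modelled by 'I_n. *)

Definition perm_len (n : nat) (w : 'S_n) : nat :=
  #|[set p : 'I_n * 'I_n | (p.1 < p.2)%N && (w p.2 < w p.1)%N]|.

(* MathComp composes permutations left to right, (s * t) x = t (s x), so the
   product w t_ij of the usual right-to-left convention, which swaps the
   entries of w in positions i and j, is tperm i j * w here. *)
Definition bruhat_step (n : nat) : rel 'S_n := fun u v =>
  [exists i : 'I_n, exists j : 'I_n,
     (v == (tperm i j * u)%g) && (perm_len u < perm_len v)%N].

Definition bruhat_le (n : nat) : rel 'S_n := connect (@bruhat_step n).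

Definition bruhat_poly (n : nat) (w : 'S_n) : {poly int} :=
  \sum_(u : 'S_n | bruhat_le u w) 'X^(perm_len u).

Definition inv_graph (n : nat) (w : 'S_n) : rel 'I_n := fun i j =>
  ((i < j)%N && (w j < w i)%N) || ((j < i)%N && (w i < w j)%N).

(* An orientation is the set of its arcs, (i, j) standing for i -> j. *)
Definition is_arc (n : nat) (O : {set 'I_n * 'I_n}) : rel 'I_n :=
  fun i j => (i, j) \in O.

Definition is_orientation (n : nat) (G : rel 'I_n) (O : {set 'I_n * 'I_n}) :=
  [forall i : 'I_n, forall j : 'I_n,
     if G i j then is_arc O i j (+) is_arc O j i else ~~ is_arc O i j].

Definition acyclic (n : nat) (O : {set 'I_n * 'I_n}) :=
  [forall i : 'I_n, forall j : 'I_n, is_arc O i j ==> ~~ connect (is_arc O) j i].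

Lemma acyclicP (n : nat) (O : {set 'I_n * 'I_n}) :
  reflect (forall c : seq 'I_n, path.cycle (is_arc O) c -> c = [::]) (acyclic O).
Proof.
apply: (iffP idP) => [acO [//|x c] /= | noc].
  case: c => [|y c] /=.
    rewrite andbT => xx; move/forallP/(_ x)/forallP/(_ x): acO.
    by rewrite xx connect0.
  case/andP=> xy pc; move/forallP/(_ x)/forallP/(_ y): acO.
  rewrite xy /=; case/negP; apply/connectP.
  by exists (rcons c x); rewrite ?last_rcons.
apply/forallP=> i; apply/forallP=> j; apply/implyP=> ij; apply/negP.
case/connectP=> p pp li; have := noc (j :: p).
by rewrite /= rcons_path pp -li ij => /(_ isT).
Qed.

Definition orientation_des (n : nat) (O : {set 'I_n * 'I_n}) : nat :=
  #|[set a in O | (a.2 < a.1)%N]|.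

Definition acyclic_poly (n : nat) (G : rel 'I_n) : {poly int} :=
  \sum_(O : {set 'I_n * 'I_n} | is_orientation G O && acyclic O)
    'X^(orientation_des O).

Definition inv_acyclic_poly (n : nat) (w : 'S_n) : {poly int} :=
  acyclic_poly (inv_graph w).

Definition avoids (n k : nat) (w : 'S_n) (s : 'S_k) : Prop :=
  ~ exists f : 'I_k -> 'I_n,
      (forall a b : 'I_k, (a < b)%N -> (f a < f b)%N) /\
      (forall a b : 'I_k, (w (f a) < w (f b))%N = (s a < s b)%N).

(* s is the usual 1-based one-line notation, whence the predecessor. *)
Definition one_line4 (s : seq nat) (i : 'I_4) : 'I_4 := inord (nth 0%N s i).-1.

Lemma one_line4_inj (s : seq nat) :
  perm_eq s [:: 1; 2; 3; 4]%N -> injective (one_line4 s).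
Proof.
move=> ps i j /(congr1 val).
have sz : size s = 4 by rewrite (perm_size ps).
have rng (k : 'I_4) : (0 < nth 0%N s k <= 4)%N.
  have : nth 0%N s k \in s by rewrite mem_nth ?sz.
  by rewrite (perm_mem ps) !inE => /or4P[] /eqP->.
have us : uniq s by rewrite (perm_uniq ps).
have /andP[i0 i4] := rng i; have /andP[j0 j4] := rng j.
rewrite /= !inordK ?prednK // => eij; apply/val_inj/eqP => /=.
have eq_nth : nth 0%N s i = nth 0%N s j by rewrite -(prednK i0) eij prednK.
by move/eqP: eq_nth; rewrite nth_uniq ?sz.
Qed.

Definition pat3412 : 'S_4 :=
  perm (@one_line4_inj [:: 3; 4; 1; 2]%N isT).
Definition pat4231 : 'S_4 :=
  perm (@one_line4_inj [:: 4; 2; 3; 1]%N isT).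

Definition is_record (n : nat) (w : 'S_n) (r : 'I_n) : bool :=
  [forall j : 'I_n, (j < r)%N ==> (w j < w r)%N].

(* The range is nonempty, as position 0 is a record. *)
Definition last_record (n : nat) (w : 'S_n) (i : 'I_n) : nat :=
  (\max_(r < n | is_record w r && (r <= i)) r)%N.

(* The value n, beyond every position, plays the role of +oo when there is no
   record position after i. *)
Definition next_record (n : nat) (w : 'S_n) (i : 'I_n) : nat :=
  \big[minn/n]_(r < n | is_record w r && (i < r)%N) r.

Definition record_exp (n : nat) (w : 'S_n) (i : 'I_n) : nat :=
  (#|[set j : 'I_n | [&& (last_record w i <= j)%N, (j < i)%N & (w i < w j)%N]]| +
   #|[set k : 'I_n | (next_record w i <= k)%N && (w k < w i)%N]|)%N.

Definition qint (a : nat) : {poly int} := \sum_(k < a) 'X^k.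

(* Main.v *)
(* Delete one entry of w and compare the three polynomials. Avoidance of 3412
   and 4231 forces one of two situations: either the entries of w from the
   position of the maximal value on are decreasing, or the values from the last
   entry on occur at decreasing positions; the second situation is the first one
   for the inverse of w. Let m be the number of inversions involving the deleted
   entry (the maximal value, resp. the last entry), and w' the remaining
   permutation.
   - P_w = [m+1] P_w': by the lifting property of the Bruhat order, the elements
     below w are those obtained from some v <= w' by inserting the maximal value
     no earlier than it occurs in w. P is invariant under inversion.
   - R_w = [m+1] R_w': the neighbours of the deleted vertex form a clique lying on
     one side of it, which an acyclic orientation of the rest orders totally, and
     the extensions to the new vertex are its m+1 insertions in this order.
   - The product gains the factor [m+1]: deleting the last entry changes no other
     exponent. Deleting the maximal value permutes the exponents up to m, because
     by 4231-avoidance the entries of the last record block that exceed some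
     later entry are decreasing and exceed all later entries. *)
Require Import Defs.
From mathcomp Require Import all_boot all_order all_algebra all_fingroup.
From mathcomp Require Import zify.

Set Implicit Arguments.
Unset Strict Implicit.
Unset Printing Implicit Defensive.

Import GRing.Theory.
Local Open Scope ring_scope.

(** * The Bruhat order *)

Lemma ltn_lift n (k : 'I_n.+1) (a b : 'I_n) : (lift k a < lift k b)%N = (a < b)%N.
Proof. by rewrite /= /bump; lia. Qed.

Lemma leq_lift n (k : 'I_n.+1) (a b : 'I_n) : (lift k a <= lift k b)%N = (a <= b)%N.
Proof. by rewrite leqNgt ltn_lift -leqNgt. Qed.

Lemma perm_ltn_neq n (u : 'S_n) (a b : 'I_n) :
  (a < b)%N -> (u a < u b)%N = ~~ (u b < u a)%N.
Proof.
move=> ab; have : u a != u b by rewrite (inj_eq perm_inj) neq_ltn ab.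
by rewrite -val_eqE /=; case: ltngtP.
Qed.

(** Transposing positions [i] and [j] sends the lost inversions injectively to gained ones, and the
    gained inversion [(i, j)] is not in the image. *)
Lemma perm_len_tperm n (u : 'S_n) (i j : 'I_n) :
  (i < j)%N -> (u i < u j)%N -> (perm_len u < perm_len (tperm i j * u)%g)%N.
Proof.
move=> ij uij.
pose I (v : 'S_n) := [set p : 'I_n * 'I_n | (p.1 < p.2)%N && (v p.2 < v p.1)%N].
pose t := tperm i j; pose tt (p : 'I_n * 'I_n) := (t p.1, t p.2).
have tt_inj : injective tt.
  by move=> [a b] [c d] [/perm_inj -> /perm_inj ->].
have sub : tt @: (I u :\: I (t * u)%g) \subset (I (t * u)%g :\: I u) :\ (i, j).
  apply/subsetP=> p /imsetP[[a b]] ; rewrite !inE /= !permM => H -> {p}.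
  rewrite /t ?tpermK -?pair_eqE /= -?val_eqE /=.
  move: H; rewrite /t; case: (tpermP i j a) => [->|->|/eqP ai /eqP aj];
  case: (tpermP i j b) => [->|->|/eqP bi /eqP bj];
  rewrite ?tpermL ?tpermR; move: uij ij;
  try lia.
  all: try move: ai aj; try move: bi bj; rewrite -?val_eqE /=; try lia.
have inB : (i, j) \in I (t * u)%g :\: I u.
  by rewrite !inE /= !permM tpermL tpermR; lia.
have := subset_leq_card sub; rewrite (card_imset _ tt_inj).
have := cardsD1 (i, j) (I (t * u)%g :\: I u); rewrite inB.
have := cardsID (I u) (I (t * u)%g); have := cardsID (I (t * u)%g) (I u).
rewrite setIC /perm_len -!/(I _) -/t => <- <- ->.
by rewrite add1n => le1; rewrite ltn_add2l ltnS.
Qed.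

Lemma perm_len_tpermE n (u : 'S_n) (i j : 'I_n) :
  (i < j)%N -> (perm_len u < perm_len (tperm i j * u)%g)%N = (u i < u j)%N.
Proof.
move=> ij; apply/idP/idP => [lt|]; last exact: perm_len_tperm.
rewrite (perm_ltn_neq _ ij); apply/negP => uji.
have := @perm_len_tperm _ (tperm i j * u)%g i j ij.
by rewrite !permM tpermL tpermR mulgA tperm2 mul1g => /(_ uji); lia.
Qed.

Lemma bruhat_stepP n (u v : 'S_n) :
  reflect (exists i j : 'I_n, [/\ (i < j)%N, (u i < u j)%N & v = (tperm i j * u)%g])
          (bruhat_step u v).
Proof.
apply: (iffP existsP) => [[i /existsP[j /andP[/eqP-> lt]]] | [i [j [ij uij ->]]]].
  case: (ltngtP i j) => [ij|ji|/val_inj eij].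
  - by exists i, j; split=> //; rewrite -perm_len_tpermE.
  - by exists j, i; rewrite tpermC in lt *; split=> //; rewrite -perm_len_tpermE.
  - by move: lt; rewrite eij tperm1 mul1g ltnn.
by exists i; apply/existsP; exists j; rewrite eqxx perm_len_tperm.
Qed.

Lemma bruhat_le_refl n (u : 'S_n) : bruhat_le u u.
Proof. exact: connect0. Qed.

Lemma bruhat_le_tperm n (u : 'S_n) (i j : 'I_n) :
  (i < j)%N -> (u i < u j)%N -> bruhat_le u (tperm i j * u)%g.
Proof. by move=> ij uij; apply/connect1/bruhat_stepP; exists i, j. Qed.

Lemma bruhat_le_tperm_inv n (u : 'S_n) (i j : 'I_n) :
  (i < j)%N -> (u j < u i)%N -> bruhat_le (tperm i j * u)%g u.
Proof.
move=> ij uji; have := @bruhat_le_tperm _ (tperm i j * u)%g i j ij.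
by rewrite !permM tpermL tpermR mulgA tperm2 mul1g; apply.
Qed.

Lemma bruhat_le_ind n (P : 'S_n -> Prop) (w : 'S_n) :
  P w ->
  (forall (u : 'S_n) (i j : 'I_n), (i < j)%N -> (u i < u j)%N ->
     bruhat_le (tperm i j * u)%g w -> P (tperm i j * u)%g -> P u) ->
  forall u, bruhat_le u w -> P u.
Proof.
move=> Pw IH u /connectP[p]; elim: p u => [|v p IHp] u /= => [_ <- //|].
case/andP => /bruhat_stepP[i [j [ij uij ->]]] pth lst.
by apply: (IH u i j ij uij); [apply/connectP; exists p | apply: IHp].
Qed.

(** Lifting property at the descent [a] of [w], by induction down a chain from [w]. Conjugating a
    step by the adjacent transposition gives a step again, because it reverses the order of no pair
    of positions except [(a, b)]. *)
Lemma bruhat_le_lifting n (w v : 'S_n) (a b : 'I_n) :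
  b = a.+1 :> nat -> (w b < w a)%N ->
  bruhat_le v w -> bruhat_le (tperm a b * v)%g w.
Proof.
move=> ba wba; elim/bruhat_le_ind => {v} [|v i j ij vij le IH].
  by apply: bruhat_le_tperm_inv => //; rewrite ba.
(* If the step swaps [a] and [b] themselves, the claim is that its upper end is below [w], which is
   known. *)
have [/andP[/eqP <- /eqP <-] //|ne] := boolP ((i == a) && (j == b)).
apply: connect_trans IH; set s := tperm a b.
have -> : (s * (tperm i j * v) = tperm (s i) (s j) * (s * v))%g.
  by rewrite -tpermJ conjgE /s tpermV -!mulgA tpermKg.
apply: bruhat_le_tperm; last by rewrite !permM /s !tpermK.
move: ne ij; rewrite /s -!val_eqE /=.
case: (tpermP a b i) => [->|->|/eqP ia /eqP ib];
case: (tpermP a b j) => [->|->|/eqP ja /eqP jb];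
  move: ba; try move: ia ib; try move: ja jb; rewrite -?val_eqE /=; lia.
Qed.

Lemma tperm_lift n (i j : 'I_n.+1) (a b : 'I_n) (s : 'S_n) :
  (tperm (lift i a) (lift i b) * lift_perm i j s = lift_perm i j (tperm a b * s))%g.
Proof.
apply/permP=> x; rewrite permM; case: (unliftP i x) => [c|] -> {x}.
  rewrite -inj_tperm; last exact: lift_inj.
  by rewrite !lift_perm_lift permM.
by rewrite tpermD ?lift_perm_id // eq_sym neq_lift.
Qed.

Lemma tperm_lift_perm_adj n (a b j : 'I_n.+1) (s : 'S_n) :
  b = a.+1 :> nat -> (tperm a b * lift_perm b j s = lift_perm a j s)%g.
Proof.
move=> ba; apply/permP=> x; rewrite permM; case: (unliftP a x) => [c|] -> {x}.
  suff -> : tperm a b (lift a c) = lift b c by rewrite !lift_perm_lift.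
  apply/val_inj; case: tpermP => [||/eqP + /eqP].
  - by move/eqP; rewrite eq_sym (negPf (neq_lift _ _)).
  - by move/(congr1 val); rewrite /= /bump; lia.
  - by rewrite -!val_eqE /= /bump; lia.
by rewrite tpermL !lift_perm_id.
Qed.

Lemma lift_perm_bij n (j : 'I_n.+1) :
  bijective (fun p : 'I_n.+1 * 'S_n => lift_perm p.1 j p.2).
Proof.
apply: inj_card_bij; last by rewrite card_prod card_ord !card_Sn factS.
move=> [k s] [k' s'] /= E.
have kk : k = k'.
  by have := congr1 (fun u : 'S_n.+1 => (u^-1)%g j) E; rewrite !lift_permV !lift_perm_id.
rewrite -kk in E *; suff -> : s = s' by []; apply/permP=> a.
have := congr1 (fun u : 'S_n.+1 => u (lift k a)) E.
by rewrite /= !lift_perm_lift => /lift_inj.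
Qed.

Lemma lift_perm_surj n (i : 'I_n.+1) (u : 'S_n.+1) :
  exists s : 'S_n, u = lift_perm i (u i) s.
Proof.
have [g _ gK] := lift_perm_bij (u i).
have := gK u; case: (g u) => k s /= E; exists s.
suff ki : k = i by rewrite -[LHS]E ki.
by apply: (@perm_inj _ u); rewrite -{1}E lift_perm_id.
Qed.

Lemma perm_lenE n (u : 'S_n) :
  perm_len u = (\sum_(i < n) \sum_(j < n) ((i < j)%N && (u j < u i)%N))%N.
Proof.
rewrite /perm_len -sum1_card big_mkcond pair_big /=; apply: eq_bigr => p _.
by rewrite inE; case: (_ && _).
Qed.

Lemma sum_leq_ord n (k : nat) : (\sum_(a < n) (k <= a) = n - k)%N.
Proof. by elim: n => [|n IH]; rewrite ?big_ord0 ?big_ord_recr ?IH /=; lia. Qed.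

Lemma sum_nat_lift n (k : 'I_n.+1) (F : 'I_n.+1 -> nat) :
  (\sum_(i < n.+1) F i = F k + \sum_(a < n) F (lift k a))%N.
Proof. exact: bigD1_ord. Qed.

Lemma perm_len_lift_max n (k : 'I_n.+1) (s : 'S_n) :
  perm_len (lift_perm k ord_max s) = (perm_len s + (n - k))%N.
Proof.
rewrite !perm_lenE (sum_nat_lift k) addnC; congr addn.
  apply: eq_bigr => a _; rewrite (sum_nat_lift k) lift_perm_id lift_perm_lift.
  rewrite (ltnNge ord_max) leq_ord andbF; apply: eq_bigr => b _.
  by rewrite !lift_perm_lift !ltn_lift.
rewrite (sum_nat_lift k) ltnn add0n -sum_leq_ord; apply: eq_bigr => b _.
rewrite lift_perm_id lift_perm_lift /= /bump; have := ltn_ord (s b).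
by case: leqP; lia.
Qed.

Lemma bruhat_le_lift n (k j : 'I_n.+1) (u v : 'S_n) :
  bruhat_le u v -> bruhat_le (lift_perm k j u) (lift_perm k j v).
Proof.
elim/bruhat_le_ind => {u} [|u a b ab uab _ IH]; first exact: bruhat_le_refl.
apply: connect_trans IH; rewrite -tperm_lift; apply: bruhat_le_tperm.
  by rewrite ltn_lift.
by rewrite !lift_perm_lift ltn_lift.
Qed.

(** The maximal value travels from [k] to [d] by adjacent swaps to the left, each of which goes
    up. *)
Lemma bruhat_le_lift_max_move n (d k : 'I_n.+1) (s : 'S_n) :
  (d <= k)%N -> bruhat_le (lift_perm k ord_max s) (lift_perm d ord_max s).
Proof.
case: k => k /=; elim: k => [|k IH] lt_k.
  by move=> d0; rewrite (_ : d = Ordinal lt_k) ?bruhat_le_refl //; apply: val_inj => /=; lia.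
rewrite leq_eqVlt => /orP[/eqP dk|dk].
  by rewrite (_ : d = Ordinal lt_k) ?bruhat_le_refl //; apply: val_inj.
have lt_k' := ltnW lt_k; apply: connect_trans (IH lt_k' dk).
rewrite -(@tperm_lift_perm_adj _ (Ordinal lt_k') (Ordinal lt_k)) //.
apply: bruhat_le_tperm => //=; rewrite lift_perm_id.
have -> : Ordinal lt_k' = lift (Ordinal lt_k) (Ordinal (lt_k : (k < n)%N)).
  by apply: val_inj; rewrite /= /bump; lia.
by rewrite lift_perm_lift /= /bump; have := ltn_ord (s (Ordinal (lt_k : (k < n)%N))); lia.
Qed.

(** * The Bruhat interval below an inserted maximal value *)

Section LiftMaxInterval.
Variables (n : nat) (d : 'I_n.+1) (w : 'S_n).
Hypothesis decr : forall a b : 'I_n, (d <= a)%N -> (a < b)%N -> (w b < w a)%N.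

(** The expected interval below [lift_perm d ord_max w]. The point is that it is closed under
    downward steps. *)
Let below (x : 'S_n.+1) :=
  exists k v, [/\ x = lift_perm k ord_max v, (d <= k)%N & bruhat_le v w].

(** Either the maximal value moves by one position and stays at or after [d], or the swap acts on
    [v], where the lifting property applies because [w] has a descent there. *)
Lemma below_adj (a b : 'I_n.+1) (x : 'S_n.+1) :
  (d <= a)%N -> b = a.+1 :> nat -> below x -> below (tperm a b * x)%g.
Proof.
move=> da ba [k [v [-> dk vw]]].
case: (unliftP k a) => [a'|] Ea; last first.
  exists b, v; rewrite -Ea -(@tperm_lift_perm_adj _ a b _ v) // tpermKg.
  by split=> //; lia.
case: (unliftP k b) => [b'|] Eb; last first.
  by exists a, v; rewrite -Eb tperm_lift_perm_adj.
exists k, (tperm a' b' * v)%g; rewrite Ea Eb tperm_lift; split=> //.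
have := congr1 val Ea; have := congr1 val Eb; rewrite /= /bump => ub ua.
by apply: bruhat_le_lifting => //; [|apply: decr]; lia.
Qed.

Lemma below_tperm (a b : 'I_n.+1) (x : 'S_n.+1) :
  (d <= a)%N -> (a < b)%N -> below x -> below (tperm a b * x)%g.
Proof.
move=> da; case: b => b lt_b /=; elim: b lt_b x => // b IH lt_b x ab bx.
have [eab|neab] := eqVneq (a : nat) b.
  by apply: below_adj => //=; rewrite eab.
have lt_b' := ltnW lt_b; pose c := Ordinal lt_b'; pose e := Ordinal lt_b.
(* The swap of [a] and [e] is that of [a] and [c] conjugated by the adjacent swap of [c] and [e]. *)
have -> : (tperm a e = tperm c e * tperm a c * tperm c e)%g.
  rewrite -[X in (X * _ * _)%g]tpermV -mulgA -conjgE tpermJ tpermL.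
  by rewrite tpermD // -val_eqE /=; lia.
rewrite -!mulgA; apply: below_adj => //=; first by lia.
by apply: IH; [lia | apply: below_adj => //=; lia].
Qed.

Lemma bruhat_le_lift_max (k : 'I_n.+1) (v : 'S_n) :
  bruhat_le (lift_perm k ord_max v) (lift_perm d ord_max w)
    = (d <= k)%N && bruhat_le v w.
Proof.
apply/idP/andP => [le|[dk vw]]; last first.
  exact: connect_trans (bruhat_le_lift _ _ vw) (bruhat_le_lift_max_move _ dk).
suff /(_ _ le)[k' [v' [E dk' vw']]] : forall u, bruhat_le u (lift_perm d ord_max w) -> below u.
  have [g gK _] := lift_perm_bij (@ord_max n).
  have := congr1 g E; rewrite (gK (k, v)) (gK (k', v')) => -[-> ->].
  by split.
apply: bruhat_le_ind; first by exists d, w; split=> //; exact: bruhat_le_refl.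
move=> u i j ij uij _ bu.
(* Going down, [u] arises from the larger permutation by the same swap, applied to entries in
   decreasing order. *)
rewrite -(tpermKg i j u); move: uij (bu).
have -> : u i = (tperm i j * u)%g j by rewrite permM tpermR.
have -> : u j = (tperm i j * u)%g i by rewrite permM tpermL.
move=> {}uij; case=> k' [v' [E dk' vw']]; rewrite E in uij bu *.
(* The maximal value is not at [j], which carries the smaller entry. If it is at [i], then [i] is at
   or after [d] and [below_tperm] applies; otherwise the swap is a step down from [v']. *)
case: (unliftP k' i) => [a|] Ei; last by apply: below_tperm => //; rewrite Ei.
case: (unliftP k' j) => [b|] Ej; last first.
  by move: uij; rewrite Ej lift_perm_id ltnNge leq_ord.
move: uij ij; rewrite Ei Ej !lift_perm_lift !ltn_lift tperm_lift => vab ab.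
exists k', (tperm a b * v')%g; split=> //.
by apply: connect_trans vw'; apply: bruhat_le_tperm_inv.
Qed.

Lemma bruhat_poly_lift_max :
  bruhat_poly (lift_perm d ord_max w) = qint (n - d).+1 * bruhat_poly w.
Proof.
rewrite /bruhat_poly (reindex _ (onW_bij _ (lift_perm_bij ord_max))) /=.
under eq_bigl => p do rewrite bruhat_le_lift_max.
under eq_bigr => p _ do rewrite perm_len_lift_max addnC exprD.
rewrite -(pair_big (fun k : 'I_n.+1 => d <= k)%N (fun v : 'S_n => bruhat_le v w)
            (fun k v => 'X^(n - k) * 'X^(perm_len v))) /=.
rewrite big_distrl /= (reindex_inj rev_ord_inj) /=.
under eq_bigr => k _ do rewrite subKn ?leq_ord // -big_distrr.
rewrite (big_ord_widen_cond n.+1 predT (fun k => 'X^k * bruhat_poly w)); last by lia.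
by apply: eq_bigl => k; have := ltn_ord k; have := ltn_ord d; rewrite /=; lia.
Qed.

End LiftMaxInterval.

Lemma perm_lenV n (u : 'S_n) : perm_len u^-1%g = perm_len u.
Proof.
pose f (p : 'I_n * 'I_n) := (u p.2, u p.1).
have f_inj : injective f by move=> [a b] [c e] [/perm_inj -> /perm_inj ->].
rewrite /perm_len -[RHS](card_imset _ f_inj); apply: eq_card => -[a b].
apply/idP/imsetP => [|[[c e]]].
  rewrite !inE /= => H; exists (u^-1 b, u^-1 a)%g; last by rewrite /f /= !permKV.
  by rewrite inE /= !permKV andbC.
by rewrite !inE /= => H [-> ->]; rewrite !permK andbC.
Qed.

Lemma bruhat_leV n (u v : 'S_n) : bruhat_le u^-1%g v^-1%g = bruhat_le u v.
Proof.
suff imp x y : bruhat_le x y -> bruhat_le (x^-1)%g (y^-1 : 'S_n)%g.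
  by apply/idP/idP => /imp; rewrite ?invgK.
elim/bruhat_le_ind => {x} [|x i j ij xij _ IH]; first exact: bruhat_le_refl.
apply: connect_trans IH.
have -> : ((tperm i j * x)^-1 = tperm (x i) (x j) * x^-1)%g.
  by rewrite invMg tpermV -tpermJ conjgE -!mulgA mulgV mulg1.
by apply: bruhat_le_tperm => //; rewrite !permK.
Qed.

Lemma bruhat_polyV n (w : 'S_n) : bruhat_poly w^-1%g = bruhat_poly w.
Proof.
rewrite /bruhat_poly (reindex_inj invg_inj) /=.
by apply: eq_big => [u|u _]; rewrite ?bruhat_leV ?perm_lenV.
Qed.

(** * Acyclic orientations *)

Section Rank.
Variables (T : finType) (N : {set T}) (f : T -> nat).
Hypothesis f_inj : {in N &, injective f}.

Let rk x := #|[set y in N | (f y < f x)%N]|.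

Lemma rank_lt x y : x \in N -> (f x < f y)%N -> (rk x < rk y)%N.
Proof.
move=> xN fxy; apply: proper_card; apply/properP; split.
  by apply/subsetP=> z; rewrite !inE => /andP[-> /ltn_trans->].
by exists x; rewrite !inE ?xN ?ltnn ?andbF.
Qed.

(** The ranks are pairwise distinct and smaller than [#|N|], so each number below [#|N|] is taken
    exactly once. *)
Lemma big_rank (R : Type) (idx : R) (op : Monoid.com_law idx) (F : nat -> R) :
  \big[op/idx]_(x in N) F #|[set y in N | (f y < f x)%N]|
    = \big[op/idx]_(p < #|N|) F p.
Proof.
rewrite -big_enum -(big_map rk predT F) -(big_mkord predT F) /index_iota subn0.
apply: perm_big.
have rk_inj : {in N &, injective rk}.
  move=> x y xN yN E; apply: f_inj => //.
  case: (ltngtP (f x) (f y)) => [/(rank_lt xN)|/(rank_lt yN)|//]; rewrite E ltnn //.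
have u : uniq [seq rk x | x <- enum N].
  by rewrite map_inj_in_uniq ?enum_uniq // => x y; rewrite !mem_enum; apply: rk_inj.
have sz : size (iota 0 #|N|) = size [seq rk x | x <- enum N].
  by rewrite size_iota size_map cardE.
apply: uniq_perm => //; first exact: iota_uniq.
have sub : {subset [seq rk x | x <- enum N] <= iota 0 #|N|}.
  move=> p /mapP[x]; rewrite mem_enum mem_iota => xN -> /=.
  rewrite add0n; apply: proper_card; apply/properP; split.
    by apply/subsetP=> y; rewrite inE => /andP[].
  by exists x => //; rewrite inE ltnn andbF.
by have [] := uniq_min_size u sub; rewrite ?sz.
Qed.

(** The index sets are the down-closed subsets of a chain, that is, its initial segments: there is
    one of each cardinality. *)
Lemma sum_down_sets (V : nmodType) (F : nat -> V) :
  \sum_(S : {set T} |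
        (S \subset N) && [forall x in N, forall y in S, (f x < f y)%N ==> (x \in S)])
     F #|S| = \sum_(p < #|N|.+1) F p.
Proof.
pose h (p : 'I_#|N|.+1) := [set x in N | (rk x < p)%N].
have h_card p : #|h p| = p :> nat.
  rewrite /h -sum1_card; under eq_bigl => x do rewrite inE.
  rewrite big_mkcondr /= (big_rank _ (fun q => if (q < p)%N then 1%N else 0%N)).
  have count m r : (\sum_(q < m) (if (q < r)%N then 1 else 0) = minn m r)%N.
    elim: m => [|m IH]; first by rewrite big_ord0; lia.
    by rewrite big_ord_recr /= IH; case: ifP; lia.
  by rewrite count; apply/minn_idPr; rewrite -ltnS.
rewrite (reindex_onto h (fun S : {set T} => inord #|S|)) /=.
  apply: eq_big => [p|p _]; last by rewrite h_card.
  rewrite h_card inord_val eqxx andbT; apply/andP; split.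
    by apply/subsetP=> x; rewrite inE => /andP[].
  apply/forall_inP=> x xN; apply/forall_inP=> y; rewrite !inE => /andP[yN yp].
  by apply/implyP=> /(rank_lt xN); rewrite xN /=; lia.
move=> S /andP[SN /forall_inP dn]; apply/setP=> x; rewrite inE inordK; last first.
  by rewrite ltnS subset_leq_card.
case xN: (x \in N) => /=; last by apply/esym/negP => /(subsetP SN); rewrite xN.
case xS: (x \in S).
  apply: proper_card; apply/properP; split.
    apply/subsetP=> y; rewrite inE => /andP[yN yx].
    by move/(_ y yN)/forall_inP/(_ x xS): dn; rewrite yx.
  by exists x; rewrite // inE ltnn andbF.
apply/negbTE; rewrite -leqNgt; apply/subset_leq_card/subsetP=> y yS.
rewrite inE (subsetP SN) //=; case: ltngtP => // [xy|E].
  by move/(_ x xN)/forall_inP/(_ y yS): dn; rewrite xy xS.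
by move: xS; rewrite -(f_inj (subsetP SN y yS) xN E) yS.
Qed.

End Rank.

Lemma acyclic_rankP n (O : {set 'I_n * 'I_n}) :
  reflect (exists f : 'I_n -> nat, forall i j, is_arc O i j -> (f i < f j)%N) (acyclic O).
Proof.
apply: (iffP idP) => [ac|[f fO]].
  (* A vertex is ranked by the number of vertices that reach it. Along an arc from [i] to [j] this
     set gains [j], which does not reach [i] by acyclicity. *)
  exists (fun i => #|[set x | connect (is_arc O) x i]|) => i j ij.
  apply: proper_card; apply/properP; split.
    by apply/subsetP=> x; rewrite !inE => /connect_trans; apply; apply: connect1.
  exists j; rewrite !inE ?connect0 //.
  by move/forallP/(_ i)/forallP/(_ j)/implyP: ac; apply.
apply/forallP=> i; apply/forallP=> j; apply/implyP=> ij; apply/negP=> /connectP[p].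
suff le : forall x, path (is_arc O) x p -> (f x <= f (last x p))%N.
  by move=> /le + lst; rewrite -lst; have := fO _ _ ij; lia.
elim: p => //= y p IH x /andP[/fO xy /IH]; lia.
Qed.

Lemma orientation_desE n (O : {set 'I_n * 'I_n}) :
  orientation_des O = (\sum_(i < n) \sum_(j < n) (((i, j) \in O) && (j < i)%N))%N.
Proof.
rewrite /orientation_des -sum1_card big_mkcond pair_big /=; apply: eq_bigr => -[i j] _.
by rewrite inE; case: (_ && _).
Qed.

(** * Deletion of a vertex whose neighbours form a clique *)

Section SimplicialVertex.
Variables (n : nat) (G : rel 'I_n.+1) (k : 'I_n.+1).
Hypotheses (Gsym : symmetric G) (Gkk : G k k = false).

Let Gd : rel 'I_n := fun a b => G (lift k a) (lift k b).
Let N := [set a : 'I_n | G k (lift k a)].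

Hypothesis clique : forall a b, a \in N -> b \in N -> a != b -> Gd a b.

(** An orientation of [G] amounts to an orientation of the remaining graph together with the set of
    in-neighbours of [k]; the other vertices of [N] become out-neighbours. *)
Let glue (q : {set 'I_n * 'I_n} * {set 'I_n}) : {set 'I_n.+1 * 'I_n.+1} :=
  [set p | match unlift k p.1, unlift k p.2 with
           | Some a, Some b => (a, b) \in q.1
           | Some a, None => a \in q.2
           | None, Some b => b \in N :\: q.2
           | None, None => false
           end].

Let cut (O : {set 'I_n.+1 * 'I_n.+1}) :=
  ([set p : 'I_n * 'I_n | (lift k p.1, lift k p.2) \in O],
   [set a : 'I_n | (lift k a, k) \in O]).

Lemma glueE q :
  [/\ forall a b, ((lift k a, lift k b) \in glue q) = ((a, b) \in q.1),
      forall a, ((lift k a, k) \in glue q) = (a \in q.2),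
      forall a, ((k, lift k a) \in glue q) = (a \in N) && (a \notin q.2)
    & ((k, k) \in glue q) = false].
Proof. by split=> *; rewrite !inE /= ?liftK ?unlift_none // !inE // andbC. Qed.

Lemma glueK : cancel glue cut.
Proof.
move=> [O S]; rewrite /cut; congr pair; apply/setP.
  by move=> [a b]; rewrite inE; have [-> _ _ _] := glueE (O, S).
by move=> a; rewrite inE; have [_ -> _ _] := glueE (O, S).
Qed.

Lemma cutK O : is_orientation G O -> glue (cut O) = O.
Proof.
move=> orO; apply/setP=> -[i j]; have [e1 e2 e3 e4] := glueE (cut O).
have or1 x y := forallP (forallP orO x) y.
case: (unliftP k i) => [a|] ->; case: (unliftP k j) => [b|] ->.
- by rewrite e1 inE.
- by rewrite e2 inE.
- rewrite e3 !inE; have := or1 k (lift k b); rewrite /is_arc.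
  by case: ifP => _; [do 2!case: (_ \in O) | move/negbTE->].
- by rewrite e4; have := or1 k k; rewrite Gkk => /negbTE.
Qed.

Lemma is_orientation_glue O S :
  is_orientation G (glue (O, S)) = is_orientation Gd O && (S \subset N).
Proof.
have [e1 e2 e3 e4] := glueE (O, S).
apply/idP/andP => [or|[or /subsetP SN]].
  have or1 x y := forallP (forallP or x) y; split.
    apply/forallP=> a; apply/forallP=> b; have := or1 (lift k a) (lift k b).
    by rewrite /is_arc !e1.
  apply/subsetP=> a aS; have := or1 (lift k a) k.
  by rewrite /is_arc e2 e3 /= aS inE Gsym; case: ifP.
apply/forallP=> i; apply/forallP=> j; rewrite /is_arc.
case: (unliftP k i) => [a|] ->; case: (unliftP k j) => [b|] ->.
- by rewrite !e1; have := forallP (forallP or a) b.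
- rewrite e2 e3 /= Gsym; case: ifP => Ga; first by rewrite inE Ga; case: (a \in S).
  by apply/negP=> /SN; rewrite inE Ga.
- by rewrite e2 e3 /= inE; case: ifP => -> //; case: (b \in S).
- by rewrite Gkk e4.
Qed.

Lemma acyclic_glue_sub O S : acyclic (glue (O, S)) -> acyclic O.
Proof.
move=> /acyclic_rankP[f fO]; apply/acyclic_rankP; exists (f \o lift k) => a b ab.
by apply: fO; have [e _ _ _] := glueE (O, S); rewrite /is_arc e.
Qed.

(** Any two vertices of the clique are joined by an arc, along which [f] increases. Hence every rank
    function induces the same total order on [N]. *)
Lemma clique_rank_inj O (f : 'I_n -> nat) :
  is_orientation Gd O -> (forall a b, is_arc O a b -> (f a < f b)%N) ->
  {in N &, forall a b, (f a < f b)%N = is_arc O a b} /\ {in N &, injective f}.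
Proof.
move=> or fO.
have arc a b : a \in N -> b \in N -> a != b -> is_arc O a b || is_arc O b a.
  move=> aN bN ab; have := forallP (forallP or a) b; rewrite clique //.
  by case: (is_arc O a b); case: (is_arc O b a).
split=> a b aN bN.
  apply/idP/idP => [fab|]; last exact: fO.
  have ab : a != b by apply: contraTneq fab => ->; rewrite ltnn.
  by case/orP: (arc a b aN bN ab) => // /fO; lia.
by move=> E; apply/eqP/negPn/negP => /(arc a b aN bN)/orP[] /fO; lia.
Qed.

Lemma acyclic_glue O (S : {set 'I_n}) (f : 'I_n -> nat) :
  is_orientation Gd O -> (forall a b, is_arc O a b -> (f a < f b)%N) -> S \subset N ->
  acyclic (glue (O, S))
    = [forall x in N, forall y in S, (f x < f y)%N ==> (x \in S)].
Proof.
move=> or fO /subsetP SN; have [fE f_inj] := clique_rank_inj or fO.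
have [e1 e2 e3 e4] := glueE (O, S).
apply/idP/idP => [/acyclic_rankP[g gO]|/forall_inP dn].
  apply/forall_inP=> x xN; apply/forall_inP=> y yS; apply/implyP=> fxy.
  apply/negPn/negP=> xS.
  (* A failure of down-closure gives the directed triangle from [k] to [x] to [y] and back to
     [k]. *)
  have := gO k (lift k x); rewrite /is_arc e3 xN xS => /(_ isT).
  have := gO (lift k y) k; rewrite /is_arc e2 yS => /(_ isT).
  have := gO (lift k x) (lift k y); rewrite /is_arc e1 /= -/(is_arc O x y) -(fE x y xN (SN y yS)).
  by move=> /(_ fxy); lia.
(* The new vertex is ranked just above its in-neighbours. *)
apply/acyclic_rankP.
exists (fun i => if unlift k i is Some a then (2 * f a).+2
                 else (\max_(s in S) (2 * f s).+3)%N) => i j; rewrite /is_arc.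
case: (unliftP k i) => [a|] ->; case: (unliftP k j) => [b|] ->.
- by rewrite e1 => /fO; rewrite ?liftK; lia.
- by rewrite e2 => aS; exact: (leq_bigmax_cond (F := fun s => (2 * f s).+3)).
(* An out-neighbour [b] has larger [f] than all of [S], and doubling leaves room for [k] in between.
   If [S] is empty, [k] gets the default rank 0, below all others. *)
- rewrite e3 => /andP[bN bS]; rewrite ltnS; apply/bigmax_leqP => s sS.
  have [//|fbs|E] := ltngtP (f s) (f b); first by lia.
    by move/(_ b bN)/forall_inP/(_ s sS): dn; rewrite fbs (negPf bS).
  by move: bS; rewrite -(f_inj _ _ (SN s sS) bN E) sS.
- by rewrite e4.
Qed.

(** Besides the descents of [O], an arc entering [k] counts when it comes from a larger vertex, and
    an arc leaving [k] when it goes to a smaller one. *)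
Lemma orientation_des_glue O S :
  orientation_des (glue (O, S))
    = (orientation_des O + (\sum_(a in S) (k < lift k a) +
                            \sum_(a in N :\: S) (lift k a < k)))%N.
Proof.
have [e1 e2 e3 e4] := glueE (O, S).
rewrite !orientation_desE (sum_nat_lift k) (sum_nat_lift k) e4 add0n addnC.
rewrite addnA; congr addn; last first.
  rewrite [RHS]big_mkcond; apply: eq_bigr => a _; rewrite e3 /= in_setD.
  by case: (a \in N); case: (a \in S).
rewrite addnC [X in (X + _)%N]big_mkcond -big_split; apply: eq_bigr => a _ /=.
rewrite (sum_nat_lift k) e2; congr addn; first by rewrite /=; case: (a \in S).
by apply: eq_bigr => b _; rewrite e1 ltn_lift.
Qed.

(** For a fixed acyclic [O], the admissible [S] are the initial segments of [N]. As [k] lies on one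
    side of [N], they add [#|S|] descents or [#|N| - #|S|] descents, and both ways the sum over [S]
    is a factor [qint #|N|.+1]. *)
Lemma acyclic_poly_simplicial :
  (forall a, a \in N -> (k < lift k a)%N) \/ (forall a, a \in N -> (lift k a < k)%N) ->
  acyclic_poly G = qint #|N|.+1 * acyclic_poly Gd.
Proof.
move=> side; rewrite /acyclic_poly (reindex_onto glue cut); last first.
  by move=> O /andP[/cutK].
rewrite (eq_bigl (fun q : {set 'I_n * 'I_n} * {set 'I_n} =>
                          (is_orientation Gd q.1 && acyclic q.1) &&
                           ((q.2 \subset N) && acyclic (glue q)))); last first.
  move=> [O S]; rewrite /= glueK eqxx andbT is_orientation_glue.
  by case ac: (acyclic (glue _)); rewrite ?andbF // (acyclic_glue_sub ac) ?andbT.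
rewrite -(pair_big_dep (fun O => is_orientation Gd O && acyclic O)
            (fun O (S : {set 'I_n}) => (S \subset N) && acyclic (glue (O, S)))
            (fun O S => 'X^(orientation_des (glue (O, S))))) /=.
rewrite big_distrr; apply: eq_bigr => O /andP[or /acyclic_rankP[f fO]] /=.
have [_ f_inj] := clique_rank_inj or fO.
rewrite (eq_bigl (fun S : {set 'I_n} => (S \subset N) &&
    [forall x in N, forall y in S, (f x < f y)%N ==> (x \in S)])); last first.
  by move=> S; case SN: (S \subset N) => //=; rewrite (acyclic_glue or fO SN).
case: side => side.
  rewrite (eq_bigr (fun S : {set 'I_n} => 'X^(#|S|) * 'X^(orientation_des O))).
    by rewrite (sum_down_sets f_inj (fun p => 'X^p * _)) -big_distrl.
  move=> S /andP[/subsetP SN _]; rewrite -exprD orientation_des_glue addnC.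
  congr ('X^(_ + _)); rewrite [X in (_ + X)%N]big1 ?addn0.
    by rewrite -sum1_card; apply: eq_bigr => a /SN/side ->.
  by move=> a /setDP[/side]; lia.
rewrite (eq_bigr (fun S : {set 'I_n} => 'X^(#|N| - #|S|) * 'X^(orientation_des O))).
  rewrite (sum_down_sets f_inj (fun p => 'X^(#|N| - p) * _)) -big_distrl /=.
  rewrite (reindex_inj rev_ord_inj) /=; congr (_ * _); apply: eq_bigr => p _.
  by rewrite subKn // -ltnS.
move=> S /andP[SN _]; rewrite -exprD orientation_des_glue addnC.
congr ('X^(_ + _)); rewrite [X in (X + _)%N]big1 ?add0n.
  rewrite -(setIidPr SN) -cardsDS ?subsetIl // -sum1_card setDIr setDv set0U.
  by apply: eq_bigr => a /setDP[/side ->].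
by move=> a /(subsetP SN)/side; lia.
Qed.

End SimplicialVertex.

(** * Pattern avoidance *)

Lemma avoids_lift n k (i j : 'I_n.+1) (s : 'S_n) (p : 'S_k) :
  avoids (lift_perm i j s) p -> avoids s p.
Proof.
move=> av [f [f_mono f_pat]]; apply: av; exists (lift i \o f); split=> [a b|a b] /=.
  by rewrite -!/(nat_of_ord (lift _ _)) ltn_lift; apply: f_mono.
by rewrite !lift_perm_lift ltn_lift f_pat.
Qed.

Lemma avoids3412P n (w : 'S_n) (i j k l : 'I_n) :
  avoids w pat3412 -> (i < j < k)%N -> (k < l)%N ->
  (w k < w l)%N -> (w l < w i)%N -> (w i < w j)%N -> False.
Proof.
move=> av /andP[ij jk] kl h1 h2 h3; apply: av.
exists (fun a : 'I_4 => nth i [:: i; j; k; l] a); split.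
  by case=> [[|[|[|[|//]]]] ?] [[|[|[|[|//]]]] ?] //=; lia.
have E a : pat3412 a = nth 0%N [:: 2; 3; 0; 1]%N a :> nat.
  by rewrite permE /one_line4 inordK; case: a => [[|[|[|[|]]]] ?].
by move=> a b; rewrite !E; case: a => [[|[|[|[|//]]]] ?];
   case: b => [[|[|[|[|//]]]] ?] //=; lia.
Qed.

Lemma avoids4231P n (w : 'S_n) (i j k l : 'I_n) :
  avoids w pat4231 -> (i < j < k)%N -> (k < l)%N ->
  (w l < w j)%N -> (w j < w k)%N -> (w k < w i)%N -> False.
Proof.
move=> av /andP[ij jk] kl h1 h2 h3; apply: av.
exists (fun a : 'I_4 => nth i [:: i; j; k; l] a); split.
  by case=> [[|[|[|[|//]]]] ?] [[|[|[|[|//]]]] ?] //=; lia.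
have E a : pat4231 a = nth 0%N [:: 3; 1; 2; 0]%N a :> nat.
  by rewrite permE /one_line4 inordK; case: a => [[|[|[|[|]]]] ?].
by move=> a b; rewrite !E; case: a => [[|[|[|[|//]]]] ?];
   case: b => [[|[|[|[|//]]]] ?] //=; lia.
Qed.

Definition decr_from n (d : nat) (w : 'S_n) :=
  forall a b : 'I_n, (d <= a)%N -> (a < b)%N -> (w b < w a)%N.

(** The bound stays [d], since deleting position [d] shifts the later positions down by one. *)
Lemma decr_from_lift n (d j : 'I_n.+1) (w : 'S_n) :
  decr_from d (lift_perm d j w) -> decr_from d w.
Proof.
move=> dec a b da ab; have := dec (lift d a) (lift d b).
rewrite !lift_perm_lift !ltn_lift; apply=> //.
by rewrite /= /bump; lia.
Qed.

Lemma decr_fromPn n d (w : 'S_n) :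
  decr_from d w \/ exists a b : 'I_n, [/\ (d <= a)%N, (a < b)%N & (w a < w b)%N].
Proof.
have [/existsP[a /existsP[b /and3P[da ab wab]]]|no] := boolP
  [exists a : 'I_n, exists b : 'I_n, [&& (d <= a)%N, (a < b)%N & (w a < w b)%N]].
  by right; exists a, b.
left=> a b da ab; apply: contraR no; rewrite -perm_ltn_neq // => wab.
by apply/existsP; exists a; apply/existsP; exists b; apply/and3P.
Qed.

(** If both alternatives fail, there are an ascent [(a, b)] behind the position [D] of the maximum
    and an ascent [(p, q)] among the values from the last entry on. Combined with [D] and the last
    position, they give a forbidden pattern. *)
Lemma smooth_dichotomy n (w : 'S_n.+1) :
  avoids w pat3412 -> avoids w pat4231 ->
  decr_from (w^-1 ord_max)%g w \/ decr_from (w ord_max) (w^-1)%g.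
Proof.
move=> av1 av2; set D := (w^-1 ord_max)%g.
have wD : w D = ord_max by rewrite permKV.
have [|[a [b [Da ab wab]]]] := decr_fromPn D w; first by left.
have [|[x [y [ex xy]]]] := decr_fromPn (w ord_max) (w^-1)%g; first by right.
set p := (w^-1 x)%g; set q := (w^-1 y)%g => pq; exfalso.
have wp : w p = x by rewrite permKV.
have wq : w q = y by rewrite permKV.
have ltD z : z != D -> (w z < w D)%N.
  move=> zD; rewrite wD /= ltn_neqAle leq_ord andbT.
  by apply: contra zD => /eqP E; apply/eqP/(@perm_inj _ w); rewrite wD; apply: val_inj.
have neD z z' : (w z < w z')%N -> (z != D :> nat).
  by move=> zz; apply: contraTneq zz => /val_inj ->; rewrite wD -leqNgt leq_ord.
have ge_e (z : 'I_n.+1) : (z < n)%N -> w z != w ord_max :> nat.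
  by move=> zn; rewrite val_eqE (inj_eq perm_inj) -val_eqE /= neq_ltn zn.
have := ltn_ord b; have := ltn_ord q; rewrite !ltnS => qn bn.
have aD := neD _ _ wab.
have := ge_e p; have := ge_e a; rewrite wp => gea gep.
have qmax : q != n :> nat.
  apply/eqP => E; have Eq : q = ord_max by apply: val_inj.
  by move: ex xy; rewrite -wq Eq; lia.
have pD : p != D :> nat by apply: (neD p q); rewrite wp wq.
have bmax : (w ord_max < w a)%N -> b != n :> nat.
  move=> ea; apply/eqP => E; move: wab.
  by rewrite (_ : b = ord_max); [lia|exact: val_inj].
(* For [p < D], the pattern is 3412 at [p, D, a, ord_max] if [w a] is below the last entry, and 4231
   at [D, a, b, ord_max] if it is above. For [D < p] it is 4231 at [D, p, q, ord_max]. *)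
case: (ltngtP p D) => [ltpD|ltDp|E]; last by rewrite E eqxx in pD.
  case: (ltngtP (w a) (w ord_max)) => [ae|ea|E]; last by have := gea; lia.
    apply: (@avoids3412P _ w p D a ord_max av1) => //=; rewrite ?wp; [lia|lia|lia|].
    by rewrite -wp; apply: ltD; rewrite -val_eqE.
  apply: (@avoids4231P _ w D a b ord_max av2) => //=; [lia|have := bmax ea; lia|].
  by apply: ltD; rewrite -val_eqE /=; lia.
apply: (@avoids4231P _ w D p q ord_max av2) => //=; rewrite ?wp ?wq; try lia.
by rewrite -wq; apply: ltD; rewrite -val_eqE /=; lia.
Qed.

(** * Deletion of an entry in the inversion graph *)

Lemma inv_acyclic_poly_simplicial n (k j : 'I_n.+1) (s : 'S_n) (m : nat) :
  let N := [set a : 'I_n | inv_graph (lift_perm k j s) k (lift k a)] in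
  #|N| = m ->
  (forall a b, a \in N -> b \in N -> a != b -> inv_graph s a b) ->
  (forall a, a \in N -> (k < lift k a)%N) \/ (forall a, a \in N -> (lift k a < k)%N) ->
  inv_acyclic_poly (lift_perm k j s) = qint m.+1 * inv_acyclic_poly s.
Proof.
move=> N <- clique side.
have E a b : inv_graph (lift_perm k j s) (lift k a) (lift k b) = inv_graph s a b.
  by rewrite /inv_graph !lift_perm_lift !ltn_lift.
rewrite /inv_acyclic_poly (acyclic_poly_simplicial (k := k)) //.
- congr (_ * _); apply: eq_bigl => O; congr andb.
  by apply: eq_forallb => a; apply: eq_forallb => b; rewrite E.
- by move=> a b; rewrite /inv_graph orbC.
- by rewrite /inv_graph ltnn.
- by move=> a b aN bN ab; rewrite E; apply: clique.
Qed.

(** The neighbours of the maximal value are the positions behind it; their entries decrease, so they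
    are pairwise inverted. *)
Lemma inv_acyclic_poly_lift_max n (d : 'I_n.+1) (w : 'S_n) :
  decr_from d w ->
  inv_acyclic_poly (lift_perm d ord_max w) = qint (n - d).+1 * inv_acyclic_poly w.
Proof.
move=> dec; set N := [set a : 'I_n | inv_graph (lift_perm d ord_max w) d (lift d a)].
have NE a : (a \in N) = (d <= a)%N.
  rewrite inE /inv_graph lift_perm_id lift_perm_lift /= /bump.
  by have := ltn_ord (w a); lia.
apply: inv_acyclic_poly_simplicial.
- by rewrite -sum_leq_ord -sum1_card big_mkcond; apply: eq_bigr => a _; rewrite NE; case: leqP.
- move=> a b; rewrite -/N !NE -val_eqE neq_ltn /inv_graph => da db /orP[ab|ba].
    by rewrite ab (dec a b).
  by rewrite ba (dec b a) // orbT.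
- by left=> a; rewrite -/N NE /= /bump; lia.
Qed.

(** The neighbours of the last position carry the larger values, which by hypothesis decrease from
    left to right and so form a clique. *)
Lemma inv_acyclic_poly_lift_last n (e : 'I_n.+1) (w : 'S_n) :
  decr_from e (w^-1)%g ->
  inv_acyclic_poly (lift_perm ord_max e w) = qint (n - e).+1 * inv_acyclic_poly w.
Proof.
move=> dec; set N := [set a : 'I_n | inv_graph (lift_perm ord_max e w) ord_max (lift ord_max a)].
have NE a : (a \in N) = (e <= w a)%N.
  rewrite inE /inv_graph lift_perm_id lift_perm_lift /= /bump.
  by have := ltn_ord a; lia.
apply: inv_acyclic_poly_simplicial.
- rewrite -sum_leq_ord -sum1_card big_mkcond [RHS](reindex_inj (@perm_inj _ w)).
  by apply: eq_bigr => a _; rewrite NE; case: leqP.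
- move=> a b; rewrite -/N !NE -(inj_eq (@perm_inj _ w)) -val_eqE neq_ltn /inv_graph.
  move=> da db /orP[ab|ba].
    by have := dec (w a) (w b) da ab; rewrite !permK => ->; rewrite ab orbT.
  by have := dec (w b) (w a) db ba; rewrite !permK => ->; rewrite ba.
- by right=> a _; rewrite /= /bump; have := ltn_ord a; lia.
Qed.

(** * Record exponents *)

(** For [a < b]: the two positions lie in different blocks when the positions are cut just before
    each record. *)
Definition sep n (w : 'S_n) (a b : 'I_n) :=
  [exists r : 'I_n, is_record w r && (a < r <= b)%N].

Lemma leq_bigminn (I : finType) (P : pred I) (F : I -> nat) (m k : nat) :
  (k < m)%N -> (\big[minn/m]_(r | P r) F r <= k)%N = [exists r, P r && (F r <= k)%N].
Proof.
move=> km; apply/idP/idP => [|/existsP[r /andP[Pr rk]]].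
  apply: contraLR; rewrite negb_exists => /forallP no; rewrite -ltnNge.
  apply: (big_ind (fun x => k < x)%N) => // [x y kx ky|r Pr]; first by rewrite leq_min kx.
  by have := no r; rewrite Pr -ltnNge.
apply: leq_trans rk; elim: (index_enum I) (mem_index_enum r) => // x s IH.
rewrite inE big_cons => /orP[/eqP <-|/IH le]; first by rewrite Pr geq_minl.
by case: ifP => // _; rewrite geq_min le orbT.
Qed.

(* Each inversion (a, b) of w is counted once: at a if some record position lies
   in ]a, b], and at b otherwise. *)
Lemma record_expE n (w : 'S_n) (i : 'I_n) :
  record_exp w i =
  (\sum_(j < n) [&& (j < i), (w i < w j) & ~~ sep w j i] +
   \sum_(j < n) [&& (i < j), (w j < w i) & sep w i j])%N.
Proof.
rewrite /record_exp; congr addn; rewrite -sum1_card big_mkcond; apply: eq_bigr => j _.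
  rewrite inE; have -> : (last_record w i <= j)%N = ~~ sep w j i.
    apply/bigmax_leqP/negP => [le /existsP[r /and3P[rec jr ri]]|no r /andP[rec ri]].
      by have := le r; rewrite rec ri => /(_ isT); lia.
    by rewrite leqNgt; apply/negP=> jr; apply: no; apply/existsP; exists r; rewrite rec jr.
  by case: (sep w j i); case: (j < i)%N; case: (w i < w j)%N.
rewrite inE; have -> : (next_record w i <= j)%N = sep w i j.
  rewrite /next_record leq_bigminn //; apply: eq_existsb => r.
  by rewrite -andbA.
have ij : sep w i j -> (i < j)%N by case/existsP=> r; lia.
by case: (sep w i j) ij => [->|_] //; rewrite ?andbF //=; case: (_ < _)%N.
Qed.

(** By [sepmax], no record separates the last position from a larger entry: such a record would be a
    still larger value further right. So all inversions of the last entry are counted at the last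
    position, and the other exponents do not change. *)
Lemma prod_record_exp_lift_last n (e : 'I_n.+1) (w : 'S_n) :
  decr_from e (w^-1)%g ->
  \prod_(i < n.+1) qint (record_exp (lift_perm ord_max e w) i).+1
    = qint (n - e).+1 * \prod_(i < n) qint (record_exp w i).+1.
Proof.
move=> dec; set u := lift_perm ord_max e w.
have uL (a : 'I_n) : u (lift ord_max a) = lift e (w a) by rewrite /u lift_perm_lift.
have umax : u ord_max = e by rewrite /u lift_perm_id.
have L_lt (a : 'I_n) : (lift ord_max a < n)%N by rewrite /= /bump; have := ltn_ord a; lia.
have rec (a : 'I_n) : is_record u (lift ord_max a) = is_record w a.
  apply/forallP/forallP => H j; last first.
    case: (unliftP ord_max j) => [b|] ->; last by rewrite ltnNge leq_ord.
    by rewrite !uL !ltn_lift.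
  by have := H (lift ord_max j); rewrite !uL !ltn_lift.
have sepL (a b : 'I_n) : sep u (lift ord_max a) (lift ord_max b) = sep w a b.
  apply/existsP/existsP => [[r]|[r H]]; last by exists (lift ord_max r); rewrite rec ltn_lift leq_lift.
  case: (unliftP ord_max r) => [c|] -> /and3P[] H1 H2; last by rewrite leqNgt L_lt.
  rewrite leq_lift => H3; exists c; move: H1 H2.
  by rewrite rec ltn_lift H3 => -> ->.
have sepmax (a : 'I_n) : (e <= w a)%N -> sep u (lift ord_max a) ord_max = false.
  move=> ea; apply/negbTE/negP=> /existsP[r /and3P[/forallP/(_ (lift ord_max a))/implyP Hr ar _]].
  have {Hr} := Hr ar; move: ar; case: (unliftP ord_max r) => [c|] -> {r} + Hr; move: Hr.
    rewrite !uL !ltn_lift => /(dec _ _ ea); rewrite !permK; lia.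
  by rewrite umax uL /= /bump; lia.
rewrite (bigD1_ord ord_max) //=; congr (_ * _).
  congr (qint _.+1); rewrite record_expE [X in (_ + X)%N]big1 ?addn0; last first.
    by move=> j _; rewrite ltnNge leq_ord.
  rewrite (sum_nat_lift ord_max) ltnn add0n -sum_leq_ord.
  rewrite [RHS](reindex_inj (@perm_inj _ w)); apply: eq_bigr => a _.
  rewrite L_lt uL umax /= /bump.
  by case: (leqP e (w a)) => ea; [rewrite sepmax|]; lia.
apply: eq_bigr => a _; congr (qint _.+1); rewrite !record_expE.
rewrite (sum_nat_lift ord_max) [X in (_ + X)%N](sum_nat_lift ord_max).
rewrite -/u umax uL; congr addn.
  rewrite (_ : (ord_max < lift ord_max a)%N = false) ?add0n; last by have := L_lt a; rewrite /=; lia.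
  by apply: eq_bigr => b _; rewrite uL sepL !ltn_lift.
rewrite (_ : [&& _, _ & _] = false) ?add0n.
  by apply: eq_bigr => b _; rewrite uL sepL !ltn_lift.
case: (leqP e (w a)) => ea; first by rewrite sepmax ?andbF.
by rewrite /= /bump; lia.
Qed.

Lemma prod_ord_geq (n d : nat) (F : nat -> {poly int}) :
  \prod_(a < n | (d <= a)%N) F (a - d)%N = \prod_(i < n - d) F i.
Proof.
elim: n => [|n IH]; first by rewrite !big_ord0.
rewrite big_mkcond big_ord_recr -big_mkcond /= IH.
case: leqP => dn; first by rewrite subSn // big_ord_recr.
by rewrite mulr1; have -> : (n.+1 - d = n - d)%N by lia.
Qed.

Lemma qint1 : qint 1 = 1.
Proof. by rewrite /qint big_ord1. Qed.

(** Both sides are [qint m.+1] times the q-factorial of [m + s]. *)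
Lemma prod_qint_shift (m s : nat) :
  \prod_(i < m) qint i.+2 * \prod_(i < s) qint (i + m).+1
  = qint m.+1 * (\prod_(i < m) qint (i + s).+1 * \prod_(i < s) qint i.+1).
Proof.
have -> : \prod_(i < m) qint i.+2 = qint m.+1 * \prod_(i < m) qint i.+1.
  transitivity (\prod_(i < m.+1) qint i.+1); first by rewrite big_ord_recl qint1 mul1r.
  by rewrite big_ord_recr mulrC.
have cat p q : \prod_(i < p) qint i.+1 * \prod_(i < q) qint (i + p).+1
               = \prod_(i < p + q) qint i.+1.
  by rewrite big_split_ord; congr (_ * _); apply: eq_bigr => i _; rewrite /= addnC.
by rewrite -mulrA cat addnC [X in _ = _ * X]mulrC cat.
Qed.

Lemma sum_interval_ord (n d a : nat) :
  (a <= n)%N -> (\sum_(b < n) (d <= b < a) = a - d)%N.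
Proof.
have -> : (\sum_(b < n) (d <= b < a) = minn a n - d)%N.
  elim: n => [|n IH]; first by rewrite big_ord0; lia.
  by rewrite big_ord_recr /= IH; lia.
by move=> an; lia.
Qed.

(** * Exponents after insertion of the maximal value *)

Section RecordExpLiftMax.
Variables (n : nat) (d : 'I_n.+1) (w : 'S_n).
Hypotheses (dec : decr_from d w) (av : avoids w pat4231).

Let u := lift_perm d ord_max w.

Let uL (a : 'I_n) : u (lift d a) = lift ord_max (w a).
Proof. exact: lift_perm_lift. Qed.

Let ud : u d = ord_max.
Proof. exact: lift_perm_id. Qed.

Let lift_lt (a : 'I_n) : (lift d a < d)%N = (a < d)%N.
Proof. by rewrite /= /bump; lia. Qed.

Let lift_gt (a : 'I_n) : (d < lift d a)%N = (d <= a)%N.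
Proof. by rewrite /= /bump; lia. Qed.

Let ltu_max x : x != d -> (u x < u d)%N.
Proof.
case: (unliftP d x) => [a|] ->; rewrite ?eqxx // uL ud => _ /=.
by rewrite /bump; have := ltn_ord (w a); lia.
Qed.

Let is_record_u_lt (a : 'I_n) : (a < d)%N -> is_record u (lift d a) = is_record w a.
Proof.
move=> ad; apply/forallP/forallP => H j.
  by have := H (lift d j); rewrite !uL !ltn_lift.
case: (unliftP d j) => [b|] ->; first by rewrite !uL !ltn_lift.
by rewrite lift_gt leqNgt ad.
Qed.

Let is_record_u_d : is_record u d.
Proof.
by apply/forallP=> j; apply/implyP=> jd; apply: ltu_max; rewrite -val_eqE /=; lia.
Qed.

Let is_record_u_gt (x : 'I_n.+1) : (d < x)%N -> is_record u x = false.
Proof.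
move=> dx; apply/negbTE/forallPn; exists d; rewrite dx /= -leqNgt ltnW //.
by apply: ltu_max; rewrite -val_eqE /=; lia.
Qed.

Let sep_u_lt (a b : 'I_n) : (b < d)%N -> sep u (lift d a) (lift d b) = sep w a b.
Proof.
move=> bd; apply/existsP/existsP => -[r]; last first.
  move=> /and3P[rec ar rb]; exists (lift d r).
  by rewrite is_record_u_lt ?rec ?ltn_lift ?ar ?leq_lift //; lia.
case: (unliftP d r) => [c|] -> /and3P[]; last by move=> _ _; rewrite leqNgt lift_lt bd.
rewrite ltn_lift leq_lift => rec ac cb; exists c.
by rewrite -is_record_u_lt ?rec ?ac //; lia.
Qed.

Let sep_u_cross (x y : 'I_n.+1) : (x < d)%N -> (d <= y)%N -> sep u x y.
Proof. by move=> xd dy; apply/existsP; exists d; rewrite is_record_u_d xd. Qed.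

Let sep_u_gt (x y : 'I_n.+1) : (d <= x)%N -> sep u x y = false.
Proof.
move=> dx; apply/negbTE/negP=> /existsP[r /and3P[]].
by case: (ltnP d r) => [/is_record_u_gt -> //|rd _ xr]; lia.
Qed.

Let record_exp_u_d : record_exp u d = 0%N.
Proof.
rewrite record_expE !big1 // => j _; first by rewrite sep_u_gt ?andbF.
by rewrite ud (ltnNge ord_max) leq_ord andbF.
Qed.

(** From [d] on, [u] is a single decreasing block, so the inversions counted are those with [d] and
    with the lifts of [d, ..., a - 1]. *)
Let record_exp_u_geq (a : 'I_n) : (d <= a)%N -> record_exp u (lift d a) = (a - d).+1.
Proof.
move=> da; have dLa : (d < lift d a)%N by rewrite lift_gt.
have Lad : lift d a != d by rewrite eq_sym neq_lift.
rewrite record_expE [X in (_ + X)%N]big1 ?addn0; last first.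
  by move=> j _; rewrite sep_u_gt ?andbF // ltnW.
rewrite (sum_nat_lift d) sep_u_gt // dLa ltu_max //.
rewrite -[RHS]add1n; congr addn.
rewrite -(sum_interval_ord d (ltnW (ltn_ord a))); apply: eq_bigr => b _.
rewrite !uL !ltn_lift; case: (leqP d b) => [db|bd].
  rewrite sep_u_gt ?andbT; last by rewrite ltnW // lift_gt.
  by case ba: (b < a)%N; rewrite //= dec.
by rewrite sep_u_cross ?andbF // ?lift_lt // ltnW.
Qed.

Let record_exp_u_lt (a : 'I_n) : (a < d)%N ->
  record_exp u (lift d a) =
  (\sum_(b < n) [&& (b < a), (w a < w b) & ~~ sep w b a] +
   \sum_(b < n) [&& (a < b), (w b < w a) & (d <= b) || sep w a b])%N.
Proof.
move=> ad; rewrite record_expE; congr addn; rewrite (sum_nat_lift d).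
  rewrite lift_gt (leqNgt d a) ad add0n.
  by apply: eq_bigr => b _; rewrite !uL !ltn_lift sep_u_lt.
rewrite ud (ltnNge ord_max) leq_ord andbF add0n.
apply: eq_bigr => b _; rewrite !uL !ltn_lift; case: (leqP d b) => [db|bd].
  by rewrite sep_u_cross ?lift_lt // ltnW // lift_gt.
by rewrite sep_u_lt.
Qed.

(** These positions have an inversion across [d] within one record block of [w]. The new record at
    [d] cuts that block, so the inversion is counted at its left end in [u] instead of its right
    end. *)
Let A := [set a : 'I_n | (a < d)%N &&
            [exists b : 'I_n, [&& (d <= b)%N, (w b < w a)%N & ~~ sep w a b]]].

Let is_record_w_gt (b c : 'I_n) : (d <= b)%N -> (b < c)%N -> is_record w c = false.
Proof.
move=> db bc; apply/negbTE/forallPn; exists b; rewrite bc /= -leqNgt ltnW //.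
exact: dec.
Qed.

Let sep_w_geq (a b : 'I_n) : (d <= a)%N -> sep w a b = false.
Proof.
move=> da; apply/negbTE/negP=> /existsP[r /and3P[+ ar]].
by rewrite (is_record_w_gt da ar).
Qed.

(** A record after [a] would have to come after the witness [b] as well, where the entries of [w]
    decrease. So [A] lies in the last block. *)
Let A_no_record (a c : 'I_n) : a \in A -> is_record w c -> (c <= a)%N.
Proof.
rewrite inE => /andP[ad /existsP[b /and3P[db _ /existsPn no]]] rec.
rewrite leqNgt; apply/negP=> ac; have := no c; rewrite rec ac /= -ltnNge => bc.
by move: rec; rewrite (is_record_w_gt db bc).
Qed.

Let A_sep (a b : 'I_n) : a \in A -> sep w a b = false.
Proof.
move=> aA; apply/negbTE/negP=> /existsP[r /and3P[rec]].
by have := A_no_record aA rec; lia.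
Qed.

(* The position of the maximal value is a record, so it comes before A; it plays
   the role of the 4 in the occurrences of 4231 below. *)
Let A_max (a : 'I_n) : a \in A ->
  exists2 r : 'I_n, (r <= a)%N & forall j, j != r -> (w j < w r)%N.
Proof.
move=> aA; case: (@arg_maxnP _ a predT (fun j => w j : nat) isT) => r _ rmax.
have mx j : j != r -> (w j < w r)%N.
  move=> jr; have le : (w j <= w r)%N := rmax j isT.
  by rewrite ltn_neqAle le andbT val_eqE (inj_eq perm_inj).
exists r => //; apply: A_no_record => //; apply/forallP=> j; apply/implyP=> jr.
by apply: mx; rewrite -val_eqE /=; lia.
Qed.

(** Otherwise the positions [r, a, b, c] form a 4231, where [c] is the witness for [a] in [A]. *)
Let A_gt (a b : 'I_n) : a \in A -> (d <= b)%N -> (w b < w a)%N.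
Proof.
move=> aA db; have [r ra rmax] := A_max aA.
move: aA; rewrite inE => /andP[ad /existsP[c /and3P[dc wca _]]].
rewrite ltnNge; apply/negP=> wab.
have {}wab : (w a < w b)%N.
  rewrite ltn_neqAle wab andbT val_eqE (inj_eq perm_inj) -val_eqE /=; lia.
have bc : (b < c)%N.
  case: (ltngtP b c) => // [/(dec dc)|/val_inj E]; first by lia.
  by move: wab; rewrite E; lia.
have bner : b != r by rewrite -val_eqE /=; lia.
have aner : a != r by apply: contraTneq wab => ->; have := rmax b bner; lia.
apply: (@avoids4231P _ w r a b c av) => //; last exact: rmax.
by move: aner; rewrite -val_eqE /=; lia.
Qed.

Let A_decr (a b : 'I_n) : a \in A -> b \in A -> (a < b)%N -> (w b < w a)%N.
Proof.
move=> aA bA ab; have [r ra rmax] := A_max aA.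
move: (aA) (bA); rewrite !inE => /andP[ad /existsP[c /and3P[dc wca _]]] /andP[bd _].
rewrite ltnNge; apply/negP=> wab.
have {}wab : (w a < w b)%N.
  rewrite ltn_neqAle wab andbT val_eqE (inj_eq perm_inj) -val_eqE /=; lia.
have bner : b != r by rewrite -val_eqE /=; lia.
have aner : a != r by apply: contraTneq wab => ->; have := rmax b bner; lia.
apply: (@avoids4231P _ w r a b c av) => //; last exact: rmax.
  by move: aner; rewrite -val_eqE /=; lia.
by lia.
Qed.

Let rkA a := #|[set b in A | (b < a)%N]|.

(** A larger entry before [a] in the same block belongs to [A] too, with the same witness as [a];
    conversely [A_decr] makes every earlier member of [A] count. *)
Let rkAE (a : 'I_n) : a \in A ->
  (\sum_(b < n) [&& (b < a), (w a < w b) & ~~ sep w b a])%N = rkA a.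
Proof.
move=> aA; rewrite /rkA -sum1_card [RHS]big_mkcond; apply: eq_bigr => b _; rewrite inE.
case ba: (b < a)%N; last by rewrite andbF.
case bA: (b \in A); first by rewrite /= A_decr // A_sep.
case wab: (w a < w b)%N => //=; case sba: (sep w b a) => //=.
case/negP: bA; move: (aA); rewrite !inE.
case/andP=> ad /existsP[c /and3P[dc wca _]]; rewrite (ltn_trans ba ad) /=.
apply/existsP; exists c; rewrite dc (ltn_trans wca wab) /=.
apply/existsPn=> r; apply/negP=> /and3P[rec br rc].
case/negP: (negbT sba); apply/existsP; exists r.
by rewrite rec br A_no_record.
Qed.

Let record_exp_out (a : 'I_n) : (a < d)%N -> a \notin A ->
  record_exp u (lift d a) = record_exp w a.
Proof.
move=> ad; rewrite inE ad /= => /existsPn aA.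
rewrite record_exp_u_lt // record_expE; congr addn; apply: eq_bigr => b _.
have := aA b; case: (leqP d b) => //= _; case: (w b < w a)%N => //=.
by rewrite negbK => ->.
Qed.

Let record_exp_u_A (a : 'I_n) : a \in A ->
  record_exp u (lift d a) = (rkA a + (n - d))%N.
Proof.
move=> aA; have ad : (a < d)%N by move: aA; rewrite inE => /andP[].
rewrite record_exp_u_lt // rkAE //; congr addn.
rewrite -sum_leq_ord; apply: eq_bigr => b _; rewrite A_sep // orbF.
case: (leqP d b) => db; last by rewrite !andbF.
by rewrite A_gt // (leq_trans ad db).
Qed.

Let record_exp_w_A (a : 'I_n) : a \in A -> record_exp w a = rkA a.
Proof.
move=> aA; rewrite record_expE rkAE // big1 ?addn0 // => b _.
by rewrite A_sep // !andbF.
Qed.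

(** The positions in [[d, a[] contribute [a - d]; before [d], exactly the members of [A] are larger
    and in the same block. *)
Let record_exp_w_geq (a : 'I_n) : (d <= a)%N -> record_exp w a = (a - d + #|A|)%N.
Proof.
move=> da; rewrite record_expE [X in (_ + X)%N]big1 ?addn0; last first.
  by move=> b _; rewrite sep_w_geq // !andbF.
rewrite -(sum_interval_ord d (ltnW (ltn_ord a))) -sum1_card [X in (_ + X)%N]big_mkcond.
rewrite -big_split; apply: eq_bigr => b _ /=.
case: (leqP d b) => [db|bd].
  have -> : (b \in A) = false by rewrite inE ltnNge db.
  rewrite sep_w_geq // andbT addn0 /=.
  by case ba: (b < a)%N; rewrite //= dec.
rewrite (leq_trans bd da) /=; case bA: (b \in A); first by rewrite A_gt // A_sep.
case wab: (w a < w b)%N => //=; case sba: (sep w b a) => //=.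
by case/negP: bA; rewrite inE bd; apply/existsP; exists a; rewrite da wab sba.
Qed.

Lemma prod_record_exp_lift_max :
  \prod_(i < n.+1) qint (record_exp u i).+1
    = qint (n - d).+1 * \prod_(i < n) qint (record_exp w i).+1.
Proof.
rewrite (bigD1_ord d) //= record_exp_u_d qint1 mul1r.
rewrite (bigID (fun a : 'I_n => d <= a)%N) /= [in RHS](bigID (fun a : 'I_n => d <= a)%N) /=.
rewrite [X in _ * X = _](bigID (mem A)) /= [X in _ = _ * (_ * X)](bigID (mem A)) /=.
have inA (a : 'I_n) : ~~ (d <= a)%N && (a \in A) = (a \in A).
  by rewrite andb_idl // inE -ltnNge => /andP[].
rewrite [X in _ * (X * _) = _](eq_bigl _ _ inA) [X in _ = _ * (_ * (X * _))](eq_bigl _ _ inA).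
rewrite (eq_bigr (fun a : 'I_n => qint (a - d).+2)); last first.
  by move=> a da; rewrite record_exp_u_geq.
rewrite (prod_ord_geq n d (fun i => qint i.+2)).
rewrite [X in _ = _ * (X * _)](eq_bigr (fun a : 'I_n => qint (a - d + #|A|).+1)); last first.
  by move=> a da; rewrite record_exp_w_geq.
rewrite (prod_ord_geq n d (fun i => qint (i + #|A|).+1)).
rewrite [X in _ * (X * _) = _](eq_bigr (fun a : 'I_n => qint (rkA a + (n - d)).+1)); last first.
  by move=> a aA; rewrite record_exp_u_A.
rewrite [X in _ = _ * (_ * (X * _))](eq_bigr (fun a : 'I_n => qint (rkA a).+1)); last first.
  by move=> a aA; rewrite record_exp_w_A.
have vinj : {in A &, injective (@nat_of_ord n)} by move=> a b _ _ /val_inj.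
rewrite (big_rank vinj _ (fun t => qint (t + (n - d)).+1)).
rewrite (big_rank vinj _ (fun t => qint t.+1)).
rewrite !mulrA; congr (_ * _); last first.
  by apply: eq_bigr => a /andP[]; rewrite -ltnNge => ad aA; rewrite record_exp_out.
(* With [m = n - d] and [s = #|A|], inserting the maximum raises the exponents on [A] by [m] and
   replaces [i + s] by [i + 1] for the [m] positions from [d] on. *)
by rewrite prod_qint_shift mulrA.
Qed.

End RecordExpLiftMax.

(** * Induction on the number of entries *)

Lemma smooth_poly_product n (w : 'S_n) :
  avoids w pat3412 -> avoids w pat4231 ->
  bruhat_poly w = \prod_(i < n) qint (record_exp w i).+1 /\
  inv_acyclic_poly w = \prod_(i < n) qint (record_exp w i).+1.
Proof.
elim: n w => [|n IH] w av1 av2.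
  rewrite big_ord0; split.
    rewrite /bruhat_poly (big_pred1 w) => [|u].
      by rewrite perm_lenE big_ord0 expr0.
    have -> : u = w by apply/permP=> -[].
    by rewrite bruhat_le_refl; apply/esym/eqP.
  rewrite /inv_acyclic_poly /acyclic_poly (big_pred1 set0) => [|O].
    by rewrite orientation_desE big_ord0 expr0.
  have -> : O = set0 by apply/setP=> -[[]].
  rewrite /= eqxx; apply/andP; split; first by apply/forallP=> -[].
  by apply/forallP=> -[].
have [dec|dec] := smooth_dichotomy av1 av2.
  set d := (w^-1 ord_max)%g in dec; have [s Ew] := lift_perm_surj d w.
  rewrite permKV in Ew; rewrite Ew in av1 av2 dec *.
  have {}dec := decr_from_lift dec.
  have [Eb Ea] := IH s (avoids_lift av1) (avoids_lift av2).
  rewrite bruhat_poly_lift_max // inv_acyclic_poly_lift_max //.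
  by rewrite prod_record_exp_lift_max ?Eb ?Ea //; apply: avoids_lift av2.
have [s Ew] := lift_perm_surj ord_max w; set e := w ord_max in dec Ew.
rewrite Ew in av1 av2 dec *; rewrite lift_permV in dec.
have {}dec := decr_from_lift dec.
have [Eb Ea] := IH s (avoids_lift av1) (avoids_lift av2).
(* For the Bruhat polynomial, pass to the inverse, where the last entry becomes the maximal
   value. *)
rewrite inv_acyclic_poly_lift_last // prod_record_exp_lift_last // -bruhat_polyV.
by rewrite lift_permV bruhat_poly_lift_max // bruhat_polyV Eb Ea.
Qed.

Theorem theorem4p2 (n : nat) (w : 'S_n) :
  avoids w pat3412 -> avoids w pat4231 ->
  bruhat_poly w = inv_acyclic_poly w /\
  inv_acyclic_poly w = \prod_(i < n) qint (record_exp w i).+1.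
Proof. by move=> av1 av2; have [-> ->] := smooth_poly_product av1 av2. Qed.
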